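(* Let $\mu$ be a distribution on $\{0,1\}^{\mathbb{N}}$ such that the space $(\mathbb{N},\xi)$ is not totally bounded, and let $\varepsilon\in(0,1]$ be such that $\mathcal{N}_\xi(\varepsilon)=\infty$. Then for all $n\ge1$, $\Delta_n(\mu)\ge\frac{\varepsilon^2}{6}$. Consequently, if $\Delta_n(\mu)\to0$ as $n\to\infty$, then $(\mathbb{N},\xi)$ is totally bounded.
   Context: For $X\sim\mu$, define $\xi(i,j):=\mathbb{P}(X_i\neq X_j)$ for $i,j\in\mathbb{N}$. For $\varepsilon>0$, $\mathcal{N}_\xi(\varepsilon)$ is the $\varepsilon$-covering number of $(\mathbb{N},\xi)$: the minimal cardinality of a set $S\subset\mathbb{N}$ such that every $i\in\mathbb{N}$ has some $s\in S$ with $\xi(i,s)\le\varepsilon$. $(\mathbb{N},\xi)$ is totally bounded if $\mathcal{N}_\xi(\varepsilon)<\infty$ for all $\varepsilon>0$. For $n\ge1$, with $X^{(1)},\dots,X^{(n)}$ i.i.d. from $\mu$, $\Delta_n(\mu):=\mathbb{E}\sup_{j\in\mathbb{N}}\left|\frac1n\sum_{i=1}^nX^{(i)}_j-\mathbb{E}[X_j]\right|$. *)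

(* Defs.v *)
From HB Require Import structures.
From mathcomp Require Import all_boot all_order all_algebra.
From mathcomp Require Import all_classical all_reals all_analysis.
From mathcomp Require Import finmap.
Set Implicit Arguments. Unset Strict Implicit. Unset Printing Implicit Defensive.
Import Order.TTheory GRing.Theory Num.Theory.
Local Open Scope classical_set_scope.
Local Open Scope ring_scope.
Local Open Scope fset_scope.

Definition coord_sets : set (set (nat -> bool)) :=
  [set A | exists (j : nat) (B : set bool), A = (fun x : nat -> bool => x j) @^-1` B].

Definition cantor : Type := g_sigma_algebraType coord_sets.

Definition xi (R : realType) (mu : probability cantor R) (i j : nat) : \bar R :=
  mu [set x : cantor | x i != x j].

Definition is_cover (R : realType) (mu : probability cantor R) (eps : R)
    (S : {fset nat}) : Prop :=
  forall i : nat, exists2 s : nat, s \in S & (xi mu i s <= eps%:E)%E.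

(* Covering number N_xi(eps): minimal cardinality of a finite eps-cover,
   +oo if there is none. *)
Definition covering_number (R : realType) (mu : probability cantor R) (eps : R)
    : \bar R :=
  ereal_inf [set ((#|` S|)%:R)%:E | S in [set S : {fset nat} | is_cover mu eps S]].

Definition totally_bounded (R : realType) (mu : probability cantor R) : Prop :=
  forall eps : R, 0 < eps -> (covering_number mu eps < +oo)%E.

Definition iid_sample (R : realType) (d : measure_display) (Omega : measurableType d)
    (P : probability Omega R) (mu : probability cantor R) (n : nat)
    (X : 'I_n -> Omega -> cantor) : Prop :=
  (forall i, measurable_fun [set: Omega] (X i)) /\
  (forall i (A : set cantor), measurable A -> P (X i @^-1` A) = mu A) /\
  (forall A : 'I_n -> set cantor, (forall i, measurable (A i)) ->
     P (\bigcap_(i in [set: 'I_n]) (X i @^-1` A i)) =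
     (\prod_(i < n) P (X i @^-1` A i))%E).

Definition dev_sup (R : realType) (d : measure_display) (Omega : measurableType d)
    (mu : probability cantor R) (n : nat) (X : 'I_n -> Omega -> cantor)
    (w : Omega) : \bar R :=
  ereal_sup [set (`| (n%:R^-1 * \sum_(i < n) ((X i w j : bool)%:R : R))%:E
                     - (\int[mu]_x ((x j : bool)%:R : R)%:E)%E |)%E | j in [set: nat]].

Definition Delta (R : realType) (d : measure_display) (Omega : measurableType d)
    (P : probability Omega R) (mu : probability cantor R) (n : nat)
    (X : 'I_n -> Omega -> cantor) : \bar R :=
  (\int[P]_w dev_sup mu X w)%E.

(* Main.v *)
(** An infinite covering number gives, for every N, N coordinates at pairwise
    distance at least eps; by pigeonhole many of them have their mean in one
    window [p, p + eps/3].  Of two such coordinates, at least one equals 1 with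
    probability at least p + eps/2.  Hence, by double counting, one sample equals
    1 on a large subset of any large family with probability almost p + eps/2.
    Passing to that subset and repeating with the next sample shows that the
    expectation of the maximum over the family of the sum of n samples is almost
    n (p + eps/2).  So some empirical mean exceeds its expectation by
    eps/2 - eps/3 = eps/6 on average.  Only finitely many coordinates are needed
    for each n and each error, so all laws involved live on finite types. *)
Require Import Defs.
From HB Require Import structures.
From mathcomp Require Import all_boot all_order all_algebra.
From mathcomp Require Import all_classical all_reals all_analysis.
From mathcomp Require Import finmap measurable_realfun ring lra.
Set Implicit Arguments. Unset Strict Implicit. Unset Printing Implicit Defensive.
Import Order.TTheory GRing.Theory Num.Theory.
Local Open Scope classical_set_scope.
Local Open Scope ring_scope.

(** * Finite families of samples, with the first one split off *)

Definition fcons (T : Type) (m : nat) (v : T) (w : {ffun 'I_m -> T}) :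
  {ffun 'I_m.+1 -> T} := [ffun i => oapp w v (unlift ord0 i)].

Lemma fcons0 (T : Type) (m : nat) (v : T) (w : {ffun 'I_m -> T}) :
  fcons v w ord0 = v.
Proof. by rewrite ffunE unlift_none. Qed.

Lemma fconsS (T : Type) (m : nat) (v : T) (w : {ffun 'I_m -> T}) (i : 'I_m) :
  fcons v w (lift ord0 i) = w i.
Proof. by rewrite ffunE liftK. Qed.

Lemma sum_ffun_recl (R : nmodType) (T : finType) (m : nat)
    (F : {ffun 'I_m.+1 -> T} -> R) :
  \sum_w F w = \sum_v \sum_w F (fcons v w).
Proof.
rewrite pair_bigA /= (reindex (fun u : T * {ffun 'I_m -> T} => fcons u.1 u.2)) //.
apply: onW_bij.
exists (fun w : {ffun 'I_m.+1 -> T} => (w ord0, [ffun i => w (lift ord0 i)])).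
  by case=> v w /=; rewrite fcons0; congr pair; apply/ffunP=> i; rewrite ffunE fconsS.
move=> w; apply/ffunP => i /=; rewrite ffunE.
by case: unliftP => [j ->|->] //=; rewrite ffunE.
Qed.

(* [w i] is the set of coordinates at which the [i]-th sample equals 1; these
   sets are independent with law [q]. *)
Definition mean_max_hits (R : realType) (I : finType) (q : {set I} -> R)
    (m : nat) (J : {set I}) : R :=
  \sum_(w : {ffun 'I_m -> {set I}})
    (\prod_(i < m) q (w i)) * (\max_(j in J) \sum_(i < m) (j \in w i))%:R.

(** * Expected maximal number of hits by independent random subsets *)

Section FiniteBound.
Variables (R : realType) (I : finType) (q : {set I} -> R).
Hypotheses (q_ge0 : forall V, 0 <= q V) (q_sum1 : \sum_V q V = 1).

Lemma prod_law_ge0 (m : nat) (w : {ffun 'I_m -> {set I}}) : 0 <= \prod_(i < m) q (w i).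
Proof. exact: prodr_ge0. Qed.

Lemma prod_law_sum1 (m : nat) :
  \sum_(w : {ffun 'I_m -> {set I}}) \prod_(i < m) q (w i) = 1.
Proof.
rewrite -(bigA_distr_bigA (fun _ => q)) big1 // => i _.
Qed.

(** Conditioning on the first sample: [G V] bounds from below the conditional mean of the maximum
    given that this sample is [V]. *)
Lemma mean_max_hitsS (m : nat) (J : {set I}) (G : {set I} -> R) :
  (forall V, G V <= \sum_(w : {ffun 'I_m -> {set I}}) (\prod_(i < m) q (w i)) *
       (\max_(j in J) ((j \in V) + \sum_(i < m) (j \in w i)))%:R) ->
  \sum_V q V * G V <= mean_max_hits q m.+1 J.
Proof.
move=> leG; rewrite /mean_max_hits sum_ffun_recl; apply: ler_sum => V _.
apply: (le_trans (ler_wpM2l (q_ge0 V) (leG V))).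
rewrite mulr_sumr; apply: ler_sum => w _; rewrite mulrA.
rewrite big_ord_recl fcons0.
rewrite le_eqVlt; apply/orP; left; apply/eqP; congr (_ * _ * _%:R).
  by apply: eq_bigr => i _; rewrite fconsS.
apply: eq_bigr => j _; rewrite big_ord_recl fcons0; congr (_ + _)%N.
by apply: eq_bigr => i _; rewrite fconsS.
Qed.

(** The coordinate of [J'] with most hits by the other samples also collects at least [a] from [V],
    and it competes in the maximum over [J]. *)
Lemma mean_max_hits_mono (m : nat) (J J' : {set I}) (a : nat) (V : {set I}) :
    J' \subset J -> (0 < #|J'|)%N -> (forall j, j \in J' -> a <= (j \in V))%N ->
  a%:R + mean_max_hits q m J' <= \sum_(w : {ffun 'I_m -> {set I}})
    (\prod_(i < m) q (w i)) * (\max_(j in J) ((j \in V) + \sum_(i < m) (j \in w i)))%:R.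
Proof.
move=> sJ J'gt0 aV.
have -> : a%:R = \sum_(w : {ffun 'I_m -> {set I}}) (\prod_(i < m) q (w i)) * a%:R.
  by rewrite -mulr_suml prod_law_sum1 mul1r.
rewrite /mean_max_hits -big_split /=.
apply: ler_sum => w _; rewrite -mulrDr; apply: ler_wpM2l; first exact: prod_law_ge0.
rewrite -natrD ler_nat.
have [j jJ' ->] := eq_bigmax_cond (fun j => \sum_(i < m) (j \in w i))%N J'gt0.
apply: (@leq_trans ((j \in V) + \sum_(i < m) (j \in w i))).
  by rewrite leq_add2r aV.
by apply: (bigop.bigmax_sup j) => //; exact: (fintype.subsetP sJ).
Qed.

(* Double counting of the pairs (j, k) in J^2 such that V contains j or k: at
   most 2 |J| |J :&: V| of them if J :&: V is small, while the mean is at least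
   c |J| (|J| - 1). *)
Lemma large_trace (J : {set I}) (c : R) (K : nat) : c <= 2 ->
    (forall j k, j \in J -> k \in J -> j != k ->
       c <= \sum_V q V * ((j \in V) || (k \in V))%:R) ->
    (0 < #|J|)%N ->
  c - (2 * K.+1)%:R / #|J|%:R <= \sum_V q V * (K <= #|J :&: V|)%:R.
Proof.
move=> c2 hit Jgt0; set N : R := #|J|%:R; set S := \sum_V _.
have muln_N (x : R) : x *+ #|J| = N * x by rewrite mulr_natl.
have N0 : 0 < N by rewrite ltr0n.
have lower : N * N * c - 2 * N <=
    \sum_(j in J) \sum_(k in J) \sum_V q V * ((j \in V) || (k \in V))%:R.
  (* Each ordered pair gets [c]. On the diagonal, where [hit] says nothing, subtracting 2 leaves a
     nonpositive term because [c <= 2]. *)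
  have -> : N * N * c - 2 * N = \sum_(j in J) \sum_(k in J) (c - 2 * (j == k)%:R).
    transitivity (\sum_(j in J) (N * c - 2)).
      by rewrite sumr_const muln_N; ring.
    apply: eq_bigr => j jJ; rewrite sumrB sumr_const muln_N -mulr_sumr.
    rewrite (bigD1 j) //= eqxx big1 ?addr0 ?mulr1 // => k /andP[_ /negbTE].
    by rewrite eq_sym => ->.
  apply: ler_sum => j jJ; apply: ler_sum => k kJ.
  case: eqVneq => [_|jk]; last by rewrite mulr0 subr0 hit.
  rewrite mulr1; apply: (@le_trans _ _ 0); first lra.
  by apply: sumr_ge0 => V _; rewrite mulr_ge0.
have upper : \sum_(j in J) \sum_(k in J) \sum_V q V * ((j \in V) || (k \in V))%:R
    <= N * N * S + 2 * K%:R * N.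
  under eq_bigr do rewrite exchange_big /=.
  rewrite exchange_big /=.
  have -> : N * N * S + 2 * K%:R * N =
      \sum_V q V * (N * N * (K <= #|J :&: V|)%:R + 2 * K%:R * N).
    under [RHS]eq_bigr do rewrite mulrDr mulrCA.
    by rewrite big_split /= -mulr_sumr -mulr_suml q_sum1 mul1r.
  apply: ler_sum => V _.
  under eq_bigr do rewrite -mulr_sumr.
  rewrite -mulr_sumr ler_wpM2l //.
  case: leqP => [_|small].
    apply: (@le_trans _ _ (N * N)); last first.
      by rewrite mulr1 lerDl !mulr_ge0 // ltW.
    have -> : N * N = \sum_(j in J) \sum_(k in J) (1 : R).
      by under eq_bigr do rewrite sumr_const muln_N mulr1; rewrite sumr_const muln_N.
    by do 2!apply: ler_sum => ? _; case: (_ || _).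
  rewrite mulr0 add0r.
  apply: (@le_trans _ _ (\sum_(j in J) \sum_(k in J) ((j \in V)%:R + (k \in V)%:R))).
    by do 2!apply: ler_sum => ? _; rewrite -natrD ler_nat; case: (_ \in V); case: (_ \in V).
  have -> : \sum_(j in J) \sum_(k in J) ((j \in V)%:R + (k \in V)%:R : R) =
      2 * N * #|J :&: V|%:R.
    have cardE : \sum_(j in J) ((j \in V)%:R : R) = #|J :&: V|%:R.
      rewrite -natr_sum -sum1_card.
      congr _%:R; rewrite [RHS](eq_bigl (fun j => (j \in J) && (j \in V))).
        by rewrite big_mkcondr.
      by move=> j; rewrite inE.
    under eq_bigr do rewrite big_split /= cardE sumr_const.
    rewrite big_split /= sumrMnl cardE sumr_const !muln_N; ring.
  have : #|J :&: V|%:R <= K%:R :> R by rewrite ler_nat ltnW.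
  by move: N0; nra.
have lu := le_trans lower upper.
(* In [lu], the [2 * N] from the diagonal and the [2 * K%:R * N] from small traces add up; division
   by [N * N] turns them into the error term with [K.+1]. *)
rewrite lerBlDr -lerBlDl ler_pdivlMr // -(ler_pM2l N0) natrM -natr1; lra.
Qed.

End FiniteBound.

(** Induction on the number of samples; half of [d] pays for small traces of the first sample, half
    for the later ones. [K] depends only on [m] and [d], because the family and its law are chosen
    after it. *)
Lemma mean_max_hits_large (R : realType) (m : nat) (d : R) : 0 < d ->
  exists K : nat, forall (I : finType) (q : {set I} -> R) (c : R) (J : {set I}),
    (forall V, 0 <= q V) -> \sum_V q V = 1 -> c <= 2 ->
    (forall j k, j \in J -> k \in J -> j != k ->
       c <= \sum_V q V * ((j \in V) || (k \in V))%:R) ->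
    (K <= #|J|)%N -> m%:R * c - d <= mean_max_hits q m J.
Proof.
elim: m d => [|m IH] d d0.
  exists 0%N => I q c J q0 q1 c2 hit _; rewrite mul0r sub0r.
  apply: (@le_trans _ _ 0); first by rewrite oppr_le0 ltW.
  by apply: sumr_ge0 => w _; rewrite mulr_ge0 // prodr_ge0.
have d2 : 0 < d / 2 by rewrite divr_gt0.
have [K0 HK] := IH _ d2.
(* The successor keeps [J :&: V] nonempty even if [K0] is 0. [B] then makes the error term of
   [large_trace] at most [d / 2]. *)
pose K := K0.+1.
pose B := Num.bound ((2 * K.+1)%:R / (d / 2)).
exists (maxn K B) => I q c J q0 q1 c2 hit; rewrite geq_max => /andP[KJ BJ].
have Jgt0 : (0 < #|J|)%N by apply: leq_trans KJ.
have Kc : (2 * K.+1)%:R / #|J|%:R <= d / 2 :> R.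
  rewrite ler_pdivrMr ?ltr0n // mulrC -ler_pdivrMr //.
  apply: (le_trans (ltW (archi_boundP _))); first by rewrite divr_ge0 // ltW.
  by rewrite ler_nat.
have big := large_trace q0 q1 K c2 hit Jgt0.
(* A large trace gains one hit and the argument goes on in [J :&: V]; otherwise nothing is gained
   and all of [J] is kept. *)
apply: le_trans (@mean_max_hitsS _ _ _ q0 m J
  (fun V => (K <= #|J :&: V|)%:R + (m%:R * c - d / 2)) _).
  under eq_bigr do rewrite mulrDr.
  rewrite big_split /= -mulr_suml q1 mul1r -natr1; lra.
move=> V; case: (boolP (K <= #|J :&: V|)%N) => [KV|_].
  apply: le_trans (mean_max_hits_mono q0 q1 m (J' := J :&: V) (a := 1) (V := V) _ _ _).
  - rewrite lerD2l; apply: HK => //; last exact: ltnW.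
    by move=> j k /setIP[? _] /setIP[? _]; exact: hit.
  - exact: finset.subsetIl.
  - exact: leq_trans KV.
  - by move=> j /setIP[_ ->].
apply: le_trans (mean_max_hits_mono q0 q1 m (J' := J) (a := 0) (V := V) _ _ _) => //.
by rewrite lerD2l; apply: HK => //; exact: ltnW.
Qed.

(** * Random variables with finitely many values *)

Section FiniteLaw.
Variables (R : realType) (d : measure_display) (Omega : measurableType d).
Variables (P : probability Omega R) (F : finType) (f : Omega -> F).
Hypothesis mf : forall b, measurable (f @^-1` [set b]).

Definition finite_law (b : F) : R := fine (P (f @^-1` [set b])).

Lemma finite_law_ge0 (b : F) : 0 <= finite_law b.
Proof. exact: fine_ge0. Qed.

Lemma finite_lawE (b : F) : (finite_law b)%:E = P (f @^-1` [set b]).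
Proof. by rewrite fineK // fin_num_measure. Qed.

Lemma finite_valued_sum (g : F -> R) (w : Omega) :
  (g (f w))%:E = (\sum_b (g b)%:E * (\1_(f @^-1` [set b]) w)%:E)%E.
Proof.
rewrite (bigD1 (f w)) //= indicE mem_set // mule1 big1 ?adde0 // => b bf.
by rewrite indicE memNset ?mule0 //= => /esym/eqP; rewrite (negbTE bf).
Qed.

Lemma measurable_finite_valued (g : F -> R) :
  measurable_fun [set: Omega] ((fun w => (g (f w))%:E) : Omega -> \bar R).
Proof.
under eq_fun do rewrite finite_valued_sum.
apply: emeasurable_sum => b; apply: emeasurable_funM; first exact: measurable_cst.
by apply/measurable_EFinP; exact: measurable_indic.
Qed.

Lemma integral_finite_valued (g : F -> R) : (forall b, 0 <= g b) ->
  (\int[P]_w (g (f w))%:E = (\sum_b finite_law b * g b)%:E)%E.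
Proof.
move=> g0; under eq_integral do rewrite finite_valued_sum.
have mind b : measurable_fun [set: Omega] ((fun w => (\1_(f @^-1` [set b]) w)%:E) : Omega -> \bar R).
  by apply/measurable_EFinP; exact: measurable_indic.
rewrite ge0_integral_sum //; first last.
- by move=> b w _; rewrite mule_ge0 // lee_fin.
- by move=> b; apply: emeasurable_funM; [exact: measurable_cst|exact: mind].
rewrite -sumEFin; apply: eq_bigr => b _.
rewrite ge0_integralZl_EFin //.
by rewrite integral_indic // setIT EFinM finite_lawE muleC.
Qed.

Lemma finite_law_sum1 : \sum_b finite_law b = 1.
Proof.
have := integral_finite_valued (fun=> ler01).
rewrite integral_cst // [X in (_ * X)%E](probability_setT P) mule1 => -[->].
by apply: eq_bigr => b _; rewrite mulr1.
Qed.

Lemma finite_law_event (B : pred F) :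
  P [set w | B (f w)] = (\sum_b finite_law b * (B b)%:R)%:E.
Proof.
rewrite -integral_finite_valued; last by move=> b; rewrite ler0n.
rewrite -[[set w | _]]setIT -integral_indic //.
  apply: eq_integral => w _; rewrite indicE; congr (_%:R)%:E.
  by case: (boolP (B (f w))) => Bw; [rewrite mem_set|rewrite memNset //; exact/negP].
rewrite (_ : [set w | _] = \bigcup_(b in [set b | B b]) f @^-1` [set b]).
  by apply: fin_bigcup_measurable => //; exact: finite_finset.
by apply/seteqP; split => [w Bw|w [b Bb /= ->]] //; exists (f w).
Qed.

End FiniteLaw.

(** * Finitely many coordinates of a random point *)

Definition trace (N : nat) (s : 'I_N -> nat) (x : cantor) : {set 'I_N} :=
  [set k | x (s k)]%SET.

Lemma measurable_coord (j : nat) (b : bool) : measurable [set x : cantor | x j = b].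
Proof. by apply: sub_sigma_algebra; exists j, [set b]. Qed.

Lemma measurable_trace (N : nat) (s : 'I_N -> nat) (V : {set 'I_N}) :
  measurable (trace s @^-1` [set V]).
Proof.
rewrite (_ : _ @^-1` _ = \bigcap_(k in [set: 'I_N]) [set x : cantor | x (s k) = (k \in V)]).
  by apply: fin_bigcap_measurable => // k _; exact: measurable_coord.
apply/seteqP; split => [x /= <- k _|x H] /=; first by rewrite inE.
by apply/setP => k; rewrite inE; exact: H.
Qed.

Definition coord_mean (R : realType) (mu : probability cantor R) (j : nat) : R :=
  fine (mu [set x : cantor | x j]).

Lemma coord_meanE (R : realType) (mu : probability cantor R) (j : nat) :
  (\int[mu]_x ((x j : bool)%:R : R)%:E = (coord_mean mu j)%:E)%E.
Proof.
have mj : measurable [set x : cantor | x j] by exact: measurable_coord.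
rewrite fineK ?fin_num_measure // -[in RHS](setIT [set x : cantor | x j]).
rewrite -integral_indic //; apply: eq_integral => x _; rewrite indicE; congr (_%:R)%:E.
by case: (boolP (x j)) => xj; [rewrite mem_set|rewrite memNset //; exact/negP].
Qed.

Lemma coord_mean_ge0 (R : realType) (mu : probability cantor R) (j : nat) :
  0 <= coord_mean mu j.
Proof. exact: fine_ge0. Qed.

Lemma coord_mean_le1 (R : realType) (mu : probability cantor R) (j : nat) :
  coord_mean mu j <= 1.
Proof.
rewrite -lee_fin fineK; first exact: probability_le1 (measurable_coord j true).
exact: fin_num_measure (measurable_coord j true).
Qed.

(* 2 * [x_j or x_k] = [x_j] + [x_k] + [x_j != x_k]. *)
Lemma union_trace (R : realType) (mu : probability cantor R) (N : nat)
    (s : 'I_N -> nat) (j k : 'I_N) (p eps : R) :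
    p <= coord_mean mu (s j) -> p <= coord_mean mu (s k) ->
    (eps%:E <= xi mu (s j) (s k))%E ->
  p + eps / 2 <=
    \sum_V finite_law mu (trace s) V * ((j \in V) || (k \in V))%:R.
Proof.
have coordE i : coord_mean mu (s i) = \sum_V finite_law mu (trace s) V * (i \in V)%:R.
  apply/EFin_inj; rewrite -coord_meanE -(integral_finite_valued _ (@measurable_trace _ s)).
    by apply: eq_integral => x _; rewrite inE.
  by move=> V; rewrite ler0n.
pose B (V : {set 'I_N}) := (j \in V) != (k \in V).
rewrite !coordE /xi.
rewrite (_ : [set x | _] = [set x | B (trace s x)]); last first.
  by apply/seteqP; split => x /=; rewrite /B !inE.
rewrite (finite_law_event mu (@measurable_trace _ s) B) lee_fin => pj pk pjk.
set S := \sum_V _.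
have -> : S = (\sum_V finite_law mu (trace s) V * (j \in V)%:R
    + \sum_V finite_law mu (trace s) V * (k \in V)%:R
    + \sum_V finite_law mu (trace s) V * (B V)%:R) / 2.
  rewrite -!big_split /= mulr_suml; apply: eq_bigr => V _.
  by rewrite /B; case: (j \in V); case: (k \in V) => /=; lra.
lra.
Qed.

(** * Choice of many separated coordinates *)

Lemma separated_points (R : realType) (mu : probability cantor R) (eps : R) :
    covering_number mu eps = +oo%E ->
  forall N : nat, exists s : 'I_N -> nat,
    forall j k : 'I_N, j != k -> (eps%:E <= xi mu (s j) (s k))%E.
Proof.
move=> cov.
(* Otherwise [S] would be a cover and its cardinality would bound the covering number. So every
   finite choice of points extends by one more. *)
have nocover (S : {fset nat}) : exists i, forall t, t \in S -> (eps%:E <= xi mu i t)%E.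
  apply: contrapT => /forallNP noi.
  suff : (covering_number mu eps <= (#|` S|%:R)%:E)%E by rewrite cov leye_eq.
  apply: ereal_inf_lbound; exists S => // i.
  have /existsNP[t /not_implyP[tS /negP]] := noi i.
  by rewrite -ltNge => /ltW; exists t.
have xiC i j : xi mu i j = xi mu j i.
  by rewrite /xi; congr (mu _); apply/seteqP; split => x /=; rewrite eq_sym.
elim=> [|N [s sP]]; first by exists (fun=> 0%N) => -[].
have [i iP] := nocover [fset s k | k in 'I_N]%fset.
have iS k : (eps%:E <= xi mu i (s k))%E by apply: iP; apply/imfsetP; exists k.
exists (fun j => oapp s i (unlift ord0 j)) => j k.
case: (unliftP ord0 j) => [j' ->|->]; case: (unliftP ord0 k) => [k' ->|->] /=.
- by rewrite (inj_eq lift_inj); exact: sP.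
- by rewrite xiC.
- by [].
- by move/eqP.
Qed.

Lemma pigeonhole (N B K : nat) (b : 'I_N -> 'I_B) : (B * K < N)%N ->
  exists c, (K <= #|[set k | b k == c]%SET|)%N.
Proof.
move=> BKN; apply/existsP; apply: contraLR BKN => /existsPn small.
rewrite -leqNgt -[X in (X <= _)%N](card_ord N) -sum1_card.
rewrite (partition_big b predT) //= -[X in (_ <= X * _)%N](card_ord B) -sum_nat_const.
apply: leq_sum => c _; have := small c; rewrite -ltnNge => /ltnW.
apply: leq_trans; rewrite -sum1_card leq_eqVlt; apply/orP; left; apply/eqP.
by apply: eq_bigl => k; rewrite inE.
Qed.

(** * Measurability and expectations for the sample *)

Lemma measurable_dev_sup (R : realType) (d : measure_display)
    (Omega : measurableType d) (P : probability Omega R) (mu : probability cantor R)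
    (n : nat) (X : 'I_n -> Omega -> cantor) : iid_sample P mu X ->
  measurable_fun [set: Omega] (dev_sup mu X : Omega -> \bar R).
Proof.
move=> [mX _].
pose f (j : nat) (w : Omega) : \bar R :=
  `| (n%:R^-1 * \sum_(i < n) ((X i w j : bool)%:R : R))%:E
     - (\int[mu]_x ((x j : bool)%:R : R)%:E)%E |%E.
(* The supremum over the tail from index 0 is the supremum over all coordinates. *)
rewrite (_ : dev_sup mu X = (fun w => esups (f^~ w) 0)); last first.
  apply/funext => w; rewrite /dev_sup /esups /sdrop /=; congr ereal_sup.
  by apply/seteqP; split => [_ [j _ <-]|_ [j _ <-]]; exists j.
apply: measurable_fun_esups => j; apply: measurableT_comp => //.
apply: emeasurable_funB; last by rewrite coord_meanE; exact: measurable_cst.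
apply/measurable_EFinP; apply: measurable_funM; first exact: measurable_cst.
apply: measurable_sum => i.
rewrite (_ : (fun w => _) = \1_(X i @^-1` [set x : cantor | x j])); last first.
  apply/funext => w; rewrite indicE; congr _%:R.
  by case: (boolP (X i w j)) => xj; [rewrite mem_set|rewrite memNset //; exact/negP].
apply: measurable_indic; rewrite -[X in measurable X]setTI; apply: mX => //.
exact: (measurable_coord j true).
Qed.

(** Carries the finite bound over to [Omega]: the expectation depends only on the joint law of the
    traces, a product law by independence. *)
Lemma integral_max_hits (R : realType) (d : measure_display)
    (Omega : measurableType d) (P : probability Omega R) (mu : probability cantor R)
    (n : nat) (X : 'I_n -> Omega -> cantor) (N : nat) (s : 'I_N -> nat)
    (J : {set 'I_N}) (a : R) : iid_sample P mu X -> 0 <= a ->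
  let hits w := ((\max_(k in J) \sum_(i < n) X i w (s k))%:R : R) in
  measurable_fun [set: Omega] ((fun w => (a * hits w)%:E) : Omega -> \bar R) /\
  (\int[P]_w (a * hits w)%:E =
    (a * mean_max_hits (finite_law mu (trace s)) n J)%:E)%E.
Proof.
move=> [mX [lawX indX]] a0 hits.
pose W (w : Omega) : {ffun 'I_n -> {set 'I_N}} := [ffun i => trace s (X i w)].
have WE v : W @^-1` [set v] =
    \bigcap_(i in [set: 'I_n]) (X i @^-1` (trace s @^-1` [set v i])).
  apply/seteqP; split => w /=; first by move=> <- i _; rewrite /= ffunE.
  by move=> H; apply/ffunP => i; rewrite ffunE; exact: H.
have mW v : measurable (W @^-1` [set v]).
  rewrite WE; apply: fin_bigcap_measurable => // i _.
  by rewrite -[X in measurable X]setTI; apply: mX => //; exact: measurable_trace.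
have lawW v : finite_law P W v = \prod_(i < n) finite_law mu (trace s) (v i).
  apply/EFin_inj; rewrite (finite_lawE P mW) WE indX; last by move=> i; exact: measurable_trace.
  rewrite -prodEFin; apply: eq_bigr => i _.
  by rewrite lawX ?finite_lawE //; exact: measurable_trace.
pose g (v : {ffun 'I_n -> {set 'I_N}}) : R :=
  a * (\max_(k in J) \sum_(i < n) (k \in v i))%:R.
have -> : (fun w => (a * hits w)%:E) = (fun w => (g (W w))%:E).
  apply/funext => w; congr (_ * _%:R)%:E; apply: eq_bigr => k _; apply: eq_bigr => i _.
  by rewrite ffunE inE.
split; first exact: (measurable_finite_valued mW g).
rewrite (integral_finite_valued P mW); last by move=> v; rewrite mulr_ge0.
congr _%:E; rewrite mulr_sumr; apply: eq_bigr => v _.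
by rewrite lawW /g mulrCA.
Qed.

(** * Lower bound on the expected deviation *)

Lemma Delta_lower_bound (R : realType) (mu : probability cantor R) (eps : R)
    (d : measure_display) (Omega : measurableType d) (P : probability Omega R)
    (n : nat) (X : 'I_n -> Omega -> cantor) :
  0 < eps <= 1 -> covering_number mu eps = +oo%E -> (0 < n)%N ->
  iid_sample P mu X -> ((eps / 6)%:E <= Delta P mu X)%E.
Proof.
move=> /andP[eps0 eps1] cov n0 iid; apply/lee_subgt0Pr => e e0.
have [K HK] := mean_max_hits_large n e0.
pose h := eps / 3; have h0 : 0 < h by rewrite divr_gt0.
(* The windows [[c * h, (c + 1) * h)] with [c < B] cover [[0, 1]]; the mean 1 falls into the last
   one. *)
pose B := (Num.trunc h^-1).+1.
(* Enough points to put [K.+1] of them into one window; [K.+1] rather than [K] makes [J]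
   nonempty. *)
have [s sep] := separated_points cov (B * K.+1).+1.
set p := fun k => coord_mean mu (s k).
have bB k : (Num.trunc (p k / h) < B)%N.
  rewrite ltnS; apply: le_truncn; rewrite ler_piMl ?coord_mean_le1 //.
  by rewrite invr_ge0 ltW.
have [c cK] := @pigeonhole _ B K.+1 (fun k => Ordinal (bB k)) (ltnSn _).
set J : {set _} := [set k | _]%SET in cK.
pose q : R := (c : nat)%:R * h.
have pJ k : k \in J -> q <= p k <= q + h.
  rewrite inE => /eqP kc.
  have tE : Num.trunc (p k / h) = c by rewrite -kc.
  have /truncn_itv : 0 <= p k / h by rewrite divr_ge0 ?coord_mean_ge0 // ltW.
  rewrite tE => /andP[lo hi]; rewrite /q -ler_pdivlMr // lo /=.
  by rewrite -[X in _ + X]mul1r -mulrDl natr1 -ler_pdivrMr // ltW.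
have [k0 k0J] : exists k, k \in J by apply/card_gt0P; exact: leq_trans cK.
have q1 : q + eps / 2 <= 2.
  have /andP[qp _] := pJ _ k0J; have := coord_mean_le1 mu (s k0).
  by rewrite -/(p k0) => p1; lra.
have large := HK _ (finite_law mu (trace s)) (q + eps / 2) J
  (fun V => finite_law_ge0 _ _ _) (finite_law_sum1 mu (@measurable_trace _ s)) q1.
have {}large := large (fun j k jJ kJ jk => union_trace
  (proj1 (andP (pJ j jJ))) (proj1 (andP (pJ k kJ))) (sep j k jk)) (ltnW cK).
have nR0 : 0 < n%:R :> R by rewrite ltr0n.
have ninv0 : 0 <= n%:R^-1 :> R by rewrite invr_ge0 ltW.
have [mhits inthits] := integral_max_hits s J iid ninv0.
have mdev := measurable_dev_sup iid.
have dev0 w : (0 <= dev_sup mu X w)%E.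
  by apply: le_trans (ereal_sup_ubound _); last (by exists 0%N); exact: abse_ge0.
have qh0 : 0 <= q + h by rewrite addr_ge0 ?mulr_ge0 // ltW.
(* Pointwise bound: the coordinate of [J] attaining the maximum has mean at most [q + h], so its
   deviation is at least its empirical mean minus [q + h]. *)
have : (\int[P]_w (n%:R^-1 * (\max_(k in J) \sum_(i < n) X i w (s k))%:R)%:E
    <= \int[P]_w (dev_sup mu X w + (q + h)%:E))%E.
  apply: ge0_le_integral => //; first by apply: emeasurable_funD.
  move=> w _.
  have [k kJ ->] := eq_bigmax_cond (fun k => \sum_(i < n) X i w (s k))%N
    (leq_trans (ltn0Sn _) cK).
  rewrite -leeBlDr //.
  apply: le_trans (ereal_sup_ubound _); last by exists (s k).
  rewrite coord_meanE -/(p k) natr_sum -!EFinB abse_EFin lee_fin.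
  apply: le_trans (ler_norm _); have /andP[_ ?] := pJ k kJ; lra.
rewrite inthits ge0_integralD //.
rewrite integral_cst // [X in (_ + _ * X)%E](probability_setT P) mule1 -/(Delta P mu X).
rewrite -leeBlDr // -EFinB; apply: le_trans; rewrite -EFinB lee_fin.
(* [large] loses [e] before the division by [n], hence at most [e] after it. *)
have n1 : 1 <= n%:R :> R by rewrite ler1n.
have {}large : q + eps / 2 - e <= n%:R^-1 * mean_max_hits (finite_law mu (trace s)) n J.
  rewrite [leRHS]mulrC ler_pdivlMr //; apply: le_trans large; nra.
by move: large; rewrite /h; lra.
Qed.

Theorem theorem4 (R : realType) :
  (forall (mu : probability cantor R) (eps : R),
     ~ totally_bounded mu -> 0 < eps <= 1 -> covering_number mu eps = +oo%E ->
     forall (d : measure_display) (Omega : measurableType d)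
            (P : probability Omega R) (n : nat) (X : 'I_n -> Omega -> cantor),
       (0 < n)%N -> iid_sample P mu X ->
       ((eps ^+ 2 / 6)%:E <= Delta P mu X)%E)
  /\
  (forall (mu : probability cantor R) (d : measure_display) (Omega : measurableType d)
          (P : probability Omega R) (X : forall n : nat, 'I_n -> Omega -> cantor),
     (forall n, iid_sample P mu (X n)) ->
     (fun n => Delta P mu (X n)) @ \oo --> 0%E ->
     totally_bounded mu).
Proof.
split=> [mu eps _ eps01 cov d Omega P n X n0 iid|mu d Omega P X iid lim0].
  (* The linear bound [eps / 6] dominates [eps ^+ 2 / 6] since [eps <= 1]. *)
  apply: le_trans (Delta_lower_bound eps01 cov n0 iid); rewrite lee_fin.
  by case/andP: eps01 => eps0 eps1; nra.
apply: contrapT => ntb; move: (ntb) => /existsNP[eps /not_implyP[eps0 ncov]].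
(* Brings the radius into the range of the lower bound; the covering number stays infinite because a
   cover at [eps'] is one at [eps]. *)
pose eps' := Num.min eps 1.
have eps'01 : 0 < eps' <= 1 by rewrite lt_min eps0 ltr01 ge_min lexx orbT.
have cov : covering_number mu eps' = +oo%E.
  apply/eqP; rewrite -leye_eq; apply: le_trans (_ : (covering_number mu eps <= _)%E).
    by rewrite leNgt; exact/negP.
  apply: le_ereal_inf => _ [S cS <-]; exists S => // i.
  have [t tS it] := cS i; exists t => //; apply: le_trans it _.
  by rewrite lee_fin ge_min lexx.
have pos : (0 < (eps' / 6)%:E)%E by case/andP: eps'01 => ? _; rewrite lte_fin divr_gt0.
(* The lower bound needs at least one sample, hence the shift. *)
have lim0S : (fun n => Delta P mu (X n.+1)) @ \oo --> 0%E by move: lim0; rewrite -cvg_shiftS.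
suff : ((eps' / 6)%:E <= 0)%E by rewrite leNgt pos.
rewrite -(cvg_lim (@ereal_hausdorff R) lim0S); apply: lime_ge; first by apply/cvg_ex; exists 0%E.
by apply: nearW => n; exact: Delta_lower_bound eps'01 cov (ltn0Sn n) (iid n.+1).
Qed.
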